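(* Let $d\ge 2$ and let $\alpha_1,\dots,\alpha_{d-1}$ be real numbers. Let $\mathbf{T}$ be the $d\times d$ symmetric Toeplitz matrix with unit diagonal and with $(i,j)$ entry equal to $\alpha_{|i-j|}$ for $i\ne j$. If $$\alpha_{d-1}\ge 0\quad\text{and}\quad 1-\alpha_1\ \ge\ \alpha_1-\alpha_2\ \ge\ \cdots\ \ge\ \alpha_{d-2}-\alpha_{d-1}\ \ge\ 0,$$ then $\mathbf{T}$ is a $d$-dimensional tail dependence matrix, i.e. $\mathbf{T}\in\mathcal{T}_d$.
   Context: For a random vector $(X_1,X_2)$ with continuous marginal distribution functions $F_1,F_2$, the (lower) tail dependence coefficient is $\chi(X_1,X_2)=\lim_{u\downarrow 0}\Pr(F_1(X_1)\le u,\,F_2(X_2)\le u)/u$, provided the limit exists. A $d$-dimensional tail dependence matrix (TDM) is a matrix of the form $(\chi(X_i,X_j))_{1\le i,j\le d}$ for some $d$-dimensional random vector $(X_1,\dots,X_d)$ with continuous marginals for which all these limits exist. $\mathcal{T}_d$ is the set of all $d$-dimensional TDMs. In the chain of inequalities the convention $\alpha_0=1$ is used, so the chain says that $\alpha_{k-1}-\alpha_k$, $k=1,\dots,d-1$, is non-increasing in $k$ and non-negative. *)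

(* Defs.v *)
From HB Require Import structures.
From mathcomp Require Import all_boot all_order all_algebra.
From mathcomp Require Import all_classical all_reals all_analysis.

Set Implicit Arguments.
Unset Strict Implicit.
Unset Printing Implicit Defensive.

Import Order.TTheory GRing.Theory Num.Theory.
Import numFieldNormedType.Exports.
Local Open Scope classical_set_scope.
Local Open Scope ring_scope.

Definition tail_ratio (disp : measure_display) (Omega : measurableType disp)
    (R : realType) (P : probability Omega R) (X Y : {RV P >-> R}) (u : R) : R :=
  fine (P [set w | (cdf X (X w) <= u%:E)%E /\ (cdf Y (Y w) <= u%:E)%E]) / u.

(* [lim] is a junk value when the limit does not exist: to be used together
   with [cvg (tail_ratio X Y u @[u --> 0^'+])]. *)
Definition tail_dependence (disp : measure_display)
    (Omega : measurableType disp) (R : realType) (P : probability Omega R)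
    (X Y : {RV P >-> R}) : R :=
  lim (tail_ratio X Y u @[u --> 0^'+]).

Definition TDM (R : realType) (d : nat) : set 'M[R]_d :=
  [set T | exists (disp : measure_display) (Omega : measurableType disp)
      (P : probability Omega R) (X : 'I_d -> {RV P >-> R}),
    [/\ forall i, continuous (cdf (X i)),
        forall i j, cvg (tail_ratio (X i) (X j) u @[u --> 0^'+]) &
        T = \matrix_(i, j) tail_dependence (X i) (X j)]].
Arguments TDM : clear implicits.

Definition toeplitz (R : realType) (d : nat) (alpha : nat -> R) : 'M[R]_d :=
  \matrix_(i, j) if i == j then 1 else alpha (absz (i%:Z - j%:Z)).

(* Main.v *)
Require Import Defs.
From HB Require Import structures.
From mathcomp Require Import all_boot all_order all_algebra.
From mathcomp Require Import all_classical all_reals all_analysis.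
From mathcomp Require Import measurable_realfun.
From mathcomp Require Import ring lra zify.
Import Order.TTheory GRing.Theory Num.Theory.
Import numFieldNormedType.Exports.
Local Open Scope classical_set_scope.
Local Open Scope ring_scope.

(** Tail dependence matrices come from random sets.  Draw a random subset [W]
of the index set such that every index belongs to [W] with the same
probability [p > 0], draw an independent [U] uniform on [[0, 1]], and let [X_i
= U] if [i] lies in [W], [X_i = U + 1] otherwise.  The lower tail of [X_i]
(levels below [p]) then lies within the event that [i] is in [W].  When [i]
and [j] are both in [W], [X_i] and [X_j] coincide, so that for [u < p] the
tail ratio of [X_i] and [X_j] is exactly [P (i, j in W) / p], whatever [u]
([TDM_of_equiprobable_events]).  Normalising a finite measure, this says that
every matrix [mu (B_i :&: B_j)] with [mu (B_i) = 1] is a tail dependence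
matrix ([TDM_of_unit_events]).

It remains to write the Toeplitz matrix in that form, with [W] a random
interval.  A convex non-increasing sequence is a non-negative combination of a
constant and of the hat functions [k |-> max (0, L - k)], and [max (0, L - |i
- j|)] counts the intervals of [L] consecutive integers that contain both [i]
and [j].  Hence one gives each interval of length [L] the second difference of
[alpha] at [L] as weight ([alpha] being continued by a constant beyond [d -
1]); the constant [alpha_(d-1)] is the weight of one more interval that
contains every index.  Summing the weights of the intervals that contain two
given points telescopes twice, once over each endpoint ([sum_windows]). *)

Definition clamp01 {R : realType} (x : R) : R := Num.max 0 (Num.min 1 x).

Lemma uniform_prob_ray {R : realType} (x : R) :
  uniform_prob (@ltr01 R) `]-oo, x] = (clamp01 x)%:E.
Proof.
rewrite /uniform_prob integral_uniform_pdf.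
have -> : `]-oo, x] `&` `[0, 1] = `[0, Num.min 1 x]%classic :> set R.
  apply/seteqP; split=> y /=; rewrite !in_itv/= le_min.
    by move=> [-> /andP[-> ->]].
  by move=> /and3P[-> -> ->].
rewrite (eq_integral (cst 1%E)); last first.
  move=> y; rewrite inE/= in_itv/= le_min => /and3P[y0 y1 _].
  by rewrite /uniform_pdf y0 y1/= subr0 invr1.
rewrite integral_cst//= mul1e lebesgue_measure_itv/= lte_fin /clamp01.
by case: ltP => // _; rewrite -EFinD subr0.
Qed.

Lemma continuous_clamp01 {R : realType} : continuous (@clamp01 R).
Proof.
move=> x; apply: continuous_max; first exact: cst_continuous.
by apply: continuous_min; [exact: cst_continuous|exact: cvg_id].
Qed.

Definition shifted_uniform {R : realType} {disp : measure_display}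
    {O : measurableType disp} (A : set O) (w : O * measurableTypeR R) : R :=
  w.2 + \1_(~` A) w.1.

(** The shift of an intersection is the larger of the two shifts.  Joint lower
tails of two shifted uniforms are therefore lower tails of a single one. *)
Lemma shifted_uniformI_le {R : realType} {disp : measure_display}
    {O : measurableType disp} (A B : set O) (w : O * measurableTypeR R)
    (r : R) :
  (shifted_uniform (A `&` B) w <= r) =
  (shifted_uniform A w <= r) && (shifted_uniform B w <= r).
Proof.
rewrite /shifted_uniform !indicE !in_setC in_setI.
by do 2 case: (_ \in _) => /=; apply/idP/andP => [|[]]; try split; lra.
Qed.

Lemma measurable_shifted_uniform {R : realType} {disp : measure_display}
    {O : measurableType disp} (A : set O) (mA : measurable A) :
  measurable_fun [set: O * measurableTypeR R] (shifted_uniform A).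
Proof.
apply: measurable_funD; first exact: measurable_snd.
apply: measurableT_comp; last exact: measurable_fst.
by apply: measurable_indic; exact: measurableC.
Qed.

(** The distribution function of a variable that is uniform on [[0, 1]] with
probability [p] and uniform on [[1, 2]] otherwise. *)
Definition mixture {R : realType} (p x : R) : R :=
  p * clamp01 x + (1 - p) * clamp01 (x - 1).

(** Below level [p] only the first component of the mixture is visible, and
it grows with slope [p]. *)
Lemma mixture_le {R : realType} (p x u : R) : 0 < u -> u < p -> p <= 1 ->
  (mixture p x <= u) = (x <= u / p).
Proof.
move=> u0 up p1; have p0 : 0 < p by lra.
rewrite ler_pdivlMr// /mixture /clamp01.
have [x1|x1] := ltP x 1.
  rewrite (@max_l _ _ 0 (Num.min 1 (x - 1))); last by rewrite ge_min; lra.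
  rewrite mulr0 addr0.
  by have [x0|x0] := leP x 0; apply/idP/idP; nra.
rewrite (max_r ler01) mulr1.
have : 0 <= (1 - p) * Num.max 0 (Num.min 1 (x - 1)).
  by rewrite mulr_ge0 ?subr_ge0// le_max lexx.
by move=> h; apply/idP/idP; nra.
Qed.

Lemma mixture_eq {R : realType} (q s : R) :
  0 < s -> s < 1 -> mixture q s = q * s.
Proof.
move=> s0 s1; rewrite /mixture /clamp01.
rewrite (min_r (ltW s1)) (max_r (ltW s0)) max_l; last by rewrite ge_min; lra.
by rewrite mulr0 addr0.
Qed.

Lemma continuous_mixture {R : realType} (p : R) : continuous (mixture p).
Proof.
move=> x; apply: cvgD; apply: cvgM; try exact: cvg_cst.
  exact: continuous_clamp01.
suff : {for x, continuous (clamp01 \o (fun y : R => y - 1))} by [].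
apply: continuous_comp; last exact: continuous_clamp01.
by apply: cvgB; [exact: cvg_id|exact: cvg_cst].
Qed.

Section events.
Context {R : realType} {disp : measure_display} {O : measurableType disp}.
Variable (nu : probability O R).

Let product_uniform := (nu \x uniform_prob (@ltr01 R))%E.

HB.instance Definition _ := Measure.on product_uniform.

Let product_uniform_setT : product_uniform setT = 1%E.
Proof.
rewrite /product_uniform -setXTT product_measure1E//.
by rewrite [X in (X * _)%E]probability_setT [LHS]mul1e; exact: probability_setT.
Qed.

HB.instance Definition _ :=
  Measure_isProbability.Build _ _ _ product_uniform product_uniform_setT.

Lemma shifted_uniform_ray (A : set O) (mA : measurable A) (r : R) :
  product_uniform [set w | shifted_uniform A w <= r] =
  (mixture (fine (nu A)) r)%:E.
Proof.
have -> : [set w | shifted_uniform A w <= r] =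
    (A `*` `]-oo, r]) `|` (~` A `*` `]-oo, r - 1]).
  apply/seteqP; split=> [[w t]|[w t]] /=; rewrite /shifted_uniform/= indicE.
    have [wA|wA] := boolP (w \in ~` A); rewrite !in_itv/=.
      by rewrite inE in wA; rewrite -lerBrDr; right.
    by move: wA; rewrite notin_setE/= notK addr0; left.
  move=> [] [wA]; rewrite in_itv/=.
    by rewrite memNset ?addr0//= notK.
  by rewrite mem_set//= -lerBrDr.
have mC : measurable (~` A) by exact: measurableC.
rewrite measureU//=; [|exact: measurableX|exact: measurableX|]; last first.
  by apply/seteqP; split=> // -[w t] /= [[wA _] [wnA _]].
rewrite /product_uniform !product_measure1E//= !uniform_prob_ray.
rewrite probability_setC//.
by rewrite -(@fineK _ (nu A)) ?fin_num_measure.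
Qed.

(** The variables are the uniform coordinate, shifted off [B i].  By
[shifted_uniformI_le] and [mixture_le], the event in the tail ratio at a level
[u < p] is the lower tail at [u / p] of the uniform shifted off
[B i `&` B j], of probability [nu (B i `&` B j) * (u / p)]. *)
Lemma TDM_of_equiprobable_events (d : nat) (B : 'I_d -> set O) (p : R) :
  0 < p -> (forall i, measurable (B i)) -> (forall i, nu (B i) = p%:E) ->
  TDM R d (\matrix_(i, j) (fine (nu (B i `&` B j)) / p)).
Proof.
move=> p0 mB nuB.
have [X XE] : exists X : 'I_d -> {RV product_uniform >-> R},
    forall i, X i = shifted_uniform (B i) :> (_ -> _).
  pose X i : {RV product_uniform >-> R} :=
    HB.pack (shifted_uniform (B i) : _ -> R)
      (isMeasurableFun.Build _ _ _ _ _
        (measurable_shifted_uniform (B i) (mB i))).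
  by exists X.
have cdfX i r : cdf (X i) r = (mixture p r)%:E.
  rewrite /cdf /distribution /pushforward XE.
  by have := shifted_uniform_ray (B i) (mB i) r; rewrite nuB.
have p1 (i : 'I_d) : p <= 1.
  by rewrite -lee_fin -(nuB i) probability_le1.
have tail i j u : 0 < u -> u < p ->
    tail_ratio (X i) (X j) u = fine (nu (B i `&` B j)) / p.
  move=> u0 up; rewrite /tail_ratio.
  have -> : [set w | (cdf (X i) (X i w) <= u%:E)%E /\
                     (cdf (X j) (X j w) <= u%:E)%E] =
      [set w | shifted_uniform (B i `&` B j) w <= u / p].
    have cdfXle k w : (cdf (X k) (X k w) <= u%:E)%E <->
        shifted_uniform (B k) w <= u / p.
      by rewrite cdfX lee_fin (mixture_le _ _ _ u0 up (p1 k)) XE.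
    apply: eq_set => w; apply/propext; split=> [[]|].
      by move=> /cdfXle Xi /cdfXle Xj; rewrite shifted_uniformI_le Xi Xj.
    rewrite shifted_uniformI_le => /andP[Xi Xj].
    by split; apply/cdfXle.
  have ray := shifted_uniform_ray _ (measurableI _ _ (mB i) (mB j)) (u / p).
  apply: (etrans (congr1 (fun x => fine x / u) ray)).
  rewrite mixture_eq ?divr_gt0 ?ltr_pdivrMr ?mul1r//=.
  by field; rewrite (gt_eqF p0) (gt_eqF u0).
have tailcvg i j :
    tail_ratio (X i) (X j) u @[u --> 0^'+] --> fine (nu (B i `&` B j)) / p.
  apply: cvg_near_cst; near=> u; apply: tail; near: u.
    exact: nbhs_right_gt.
  exact: nbhs_right_lt.
exists _, _, (product_uniform : probability _ R), X; split.
- move=> i x; rewrite (_ : cdf (X i) = EFin \o mixture p); last exact/funext.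
  by apply: cvg_EFin; [exact: nearW|exact: continuous_mixture].
- by move=> i j; apply/cvg_ex; eexists; exact: tailcvg.
- apply/matrixP => i j; rewrite !mxE /tail_dependence.
  by apply/esym/cvg_lim => //; exact: tailcvg.
Unshelve. all: by end_near. Qed.
End events.

(** After normalisation the events have common probability [(mu setT)^-1];
dividing by it undoes the normalisation. *)
Lemma TDM_of_unit_events {R : realType} {disp : measure_display}
    {O : measurableType disp} (mu : {measure set O -> \bar R}) (d : nat)
    (B : 'I_d -> set O) :
  (0 < d)%N -> (mu setT < +oo)%E ->
  (forall i, measurable (B i)) -> (forall i, mu (B i) = 1%E) ->
  TDM R d (\matrix_(i, j) fine (mu (B i `&` B j))).
Proof.
case: d B => // d B _ mu_fin mB muB.
have mu_ge1 : (1 <= mu setT)%E.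
  by rewrite -(muB ord0) le_measure ?inE//; exact: subsetT.
have mu_num : mu setT \is a fin_num by rewrite ge0_fin_numE.
have mass_gt0 : 0 < fine (mu setT).
  by rewrite fine_gt0// mu_fin (lt_le_trans _ mu_ge1)// lte01.
pose nu : probability O R := mnormalize mu (dirac point).
have nuE A : nu A = (mu A * (fine (mu setT))^-1%:E)%E.
  rewrite /nu/= /mnormalize gt_eqF ?lt_eqF//.
  exact: lt_le_trans lte01 mu_ge1.
have p_gt0 : 0 < (fine (mu setT))^-1 by rewrite invr_gt0.
have nuB i : nu (B i) = (fine (mu setT))^-1%:E by rewrite nuE muB mul1e.
have := TDM_of_equiprobable_events nu _ B _ p_gt0 mB nuB.
congr (TDM R _ _); apply/matrixP => i j; rewrite !mxE nuE.
have muBI : mu (B i `&` B j) \is a fin_num.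
  rewrite ge0_fin_numE// (le_lt_trans _ mu_fin)// le_measure ?inE//.
  exact: measurableI.
by rewrite fineM//= invrK mulfVK ?gt_eqF.
Qed.

(** Here [(a, l)] stands for the integer interval [[a, a + l]], which
contains the points [m <= M] when [a <= m] and [M <= a + l].  For fixed [a]
the sum over [l] of the second differences of [b] telescopes to the first
difference at [M - a], and the sum over [a] of these telescopes again. *)
Lemma sum_windows {R : realType} (b : nat -> R) (N m M : nat) :
  b N = b N.+1 -> (m <= M)%N -> (M < N)%N ->
  \sum_(a < N) \sum_(l < N) ((b l - b l.+1) - (b l.+1 - b l.+2)) *
     ((a <= m)%N && (M <= a + l)%N)%:R
  = b (M - m)%N - b M.+1.
Proof.
move=> bN mM MN.
have inner (a : nat) : \sum_(l < N) ((b l - b l.+1) - (b l.+1 - b l.+2)) *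
     ((a <= m)%N && (M <= a + l)%N)%:R =
     if (a <= m)%N then b (M - a)%N - b (M - a).+1 else 0.
  have [am|am] := leqP a m; last by rewrite big1// => l _; rewrite mulr0.
  pose v k := b k.+1 - b k.
  transitivity (\sum_(M - a <= l < N) (v l.+1 - v l)).
    rewrite (big_nat_widenl _ 0%N)//= [RHS]big_mkcond/= big_mkord.
    apply: eq_bigr => l _; rewrite -leq_subLR.
    by case: leqP => _; rewrite ?mulr1 ?mulr0// /v; ring.
  rewrite telescope_sumr; last lia.
  by rewrite /v -bN; ring.
under eq_bigr do rewrite inner.
rewrite -big_mkcond/=.
rewrite -(big_mkord (fun a => (a <= m)%N)
  (fun a => b (M - a)%N - b (M - a).+1)).
transitivity (\sum_(0 <= a < m.+1) (b (M.+1 - a.+1)%N - b (M.+1 - a)%N)).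
  rewrite [RHS](big_nat_widen _ _ N)//=; last lia.
  by apply: eq_bigr => a am; rewrite subSS subSn//; lia.
by rewrite telescope_sumr// subn0 subSS.
Qed.

(** A pair [(a, b)] encodes the integer interval [[a, b]].  Every interval
[[a, a + l]] with [a, l < N] gets weight [w l], and [[0, N]], which contains
all the points of interest, gets the additional weight [c]. *)
Definition window_measure {R : realType} (c : {nonneg R})
    (w : nat -> {nonneg R}) (N : nat) : {measure set (nat * nat) -> \bar R} :=
  measure_add (mscale c (dirac (0%N, N)))
    (msum (fun a => msum (fun l => mscale (w l) (dirac (a, a + l)%N)) N) N).

Lemma window_measureE {R : realType} (c : {nonneg R}) (w : nat -> {nonneg R})
    (N : nat) (A : set (nat * nat)) :
  window_measure c w N A =
  (c%:num * \1_A (0%N, N) +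
   \sum_(a < N) \sum_(l < N) (w l)%:num * \1_A (nat_of_ord a, a + l)%N)%:E.
Proof.
rewrite [LHS]measure_addE /= /msum /mscale/= EFinD; congr (_ + _)%E.
rewrite -sumEFin; apply: eq_bigr => a _.
by rewrite -sumEFin; apply: eq_bigr => l _.
Qed.

Definition windows_through (x : nat) : set (nat * nat) :=
  [set ab | ab.1 <= x <= ab.2]%N.

Lemma measurable_windows_through (x : nat) : measurable (windows_through x).
Proof.
have -> : windows_through x = [set a | (a <= x)%N] `*` [set b | (x <= b)%N].
  by apply/seteqP; split=> -[a b] /=; rewrite /windows_through/= => /andP.
exact: measurableX.
Qed.

Lemma indic_windows_throughI {R : realType} (x y a b : nat) :
  \1_(windows_through x `&` windows_through y) (a, b) =
  ((a <= minn x y)%N && (maxn x y <= b)%N)%:R :> R.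
Proof.
rewrite indicE; congr ((nat_of_bool _)%:R).
by apply/asboolP/andP; rewrite /windows_through/= leq_min geq_max;
  move=> [/andP[-> ->] /andP[-> ->]].
Qed.

(** Continuing [alpha] by the constant [alpha d.-1] keeps it convex: the only
new condition, at the junction, is that the last step of [alpha] is downwards.
The constant continuation spares all case distinctions on the length of the
intervals. *)
Lemma second_difference_ge0 {R : realType} (d : nat) (alpha : nat -> R) :
  (2 <= d)%N ->
  (forall k, (1 <= k)%N -> (k.+1 <= d.-1)%N ->
     alpha k - alpha k.+1 <= alpha k.-1 - alpha k) ->
  0 <= alpha d.-2 - alpha d.-1 ->
  let b k := alpha (minn k d.-1) in
  forall l, 0 <= (b l - b l.+1) - (b l.+1 - b l.+2).
Proof.
move=> hd chain last b l; rewrite /b subr_ge0.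
have [ld|ld] := leqP l.+2 d.-1.
  by rewrite !(minn_idPl _); [exact: chain| lia..].
rewrite (@minn_idPr l.+1 d.-1 _) ?subrr; last lia.
have [->|ld'] := eqVneq l d.-2.
  by rewrite (minn_idPl _)//; lia.
by rewrite (@minn_idPr l d.-1 _) ?subrr//; lia.
Qed.

Theorem proposition2p2 (R : realType) (d : nat) (hd : (2 <= d)%N)
    (alpha : nat -> R)
    (alpha0 : alpha 0%N = 1)
    (alpha_last : 0 <= alpha d.-1)
    (alpha_chain : forall k : nat, (1 <= k)%N -> (k.+1 <= d.-1)%N ->
       alpha k - alpha k.+1 <= alpha k.-1 - alpha k)
    (alpha_diff_last : 0 <= alpha d.-2 - alpha d.-1) :
  TDM R d (toeplitz d alpha).
Proof.
pose b k := alpha (minn k d.-1).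
have b_convex := second_difference_ge0 d alpha hd alpha_chain alpha_diff_last.
pose mu := window_measure (NngNum alpha_last)
  (fun l => NngNum (b_convex l)) (d + d).
(* The indices are placed at [d, .., 2d - 1]: far enough to the right of 0 that
   the telescoping over left endpoints, which stops at 0, reaches the range
   where [b] is constant. *)
pose B (i : 'I_d) := windows_through (d + i).
have b_tail k : (d.-1 <= k)%N -> b k = alpha d.-1.
  by rewrite /b => /minn_idPr ->.
have muBI (i j : 'I_d) :
    mu (B i `&` B j) = (alpha `|i%:Z - j%:Z|%N)%:E.
  have [i_lt j_lt] := (ltn_ord i, ltn_ord j).
  rewrite window_measureE; congr EFin.
  under eq_bigr do under eq_bigr do rewrite indic_windows_throughI.
  rewrite indic_windows_throughI (sum_windows b)//=;
    [|by rewrite !b_tail//; lia|lia..].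
  rewrite (b_tail (maxn _ _).+1); last lia.
  rewrite (_ : (maxn _ _ <= _)%N = true); last lia.
  rewrite mulr1 [LHS]addrC subrK /b; congr alpha; lia.
have muB (i : 'I_d) : mu (B i) = 1%E.
  by rewrite -[X in mu X]setIid muBI subrr absz0 alpha0.
have mB (i : 'I_d) := measurable_windows_through (d + i).
have := TDM_of_unit_events mu d B _ _ mB muB.
rewrite (_ : \matrix_(i, j) _ = toeplitz d alpha); last first.
  apply/matrixP => i j; rewrite !mxE muBI/=.
  by case: eqVneq => // ->; rewrite subrr absz0 alpha0.
apply; first lia.
by rewrite window_measureE ltry.
Qed.
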